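(* Let $S$ be a regular semigroup and let $E(S)$ be its set of idempotents. The following are equivalent: (1) $S$ is weakly right noetherian; (2) for every subset $U\subseteq E(S)$, there exists a finite set $X\subseteq U$ with the following property: for each $u\in U$ there exists $x\in X$ such that $u=xu$.
   Context: A semigroup $S$ is regular if for every $a\in S$ there is $b\in S$ with $a=aba$ and $b=bab$. A right ideal of $S$ is a subset $I\subseteq S$ with $IS\subseteq I$; it is finitely generated if $I=X\cup XS$ for some finite $X\subseteq I$. A semigroup is weakly right noetherian if every right ideal of it is finitely generated. *)

(* Defs.v *)
From mathcomp Require Import all_boot.
From mathcomp Require Import boolp classical_sets functions cardinality.

Set Implicit Arguments.
Unset Strict Implicit.
Unset Printing Implicit Defensive.

Local Open Scope classical_set_scope.
Local Open Scope group_scope.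

Definition set_mul (S : semigroupType) (A B : set S) : set S :=
  [set a * b | a in A & b in B].

Definition regular_semigroup (S : semigroupType) : Prop :=
  forall a : S, exists b : S, a = a * b * a /\ b = b * a * b.

(* The empty set counts as a right ideal (generated by the empty set). *)
Definition right_ideal (S : semigroupType) (I : set S) : Prop :=
  set_mul I [set: S] `<=` I.

Definition fg_right_ideal (S : semigroupType) (I : set S) : Prop :=
  exists X : set S,
    [/\ finite_set X, X `<=` I & I = X `|` set_mul X [set: S]].

Definition weakly_right_noetherian (S : semigroupType) : Prop :=
  forall I : set S, right_ideal I -> fg_right_ideal I.

Definition idempotents (S : semigroupType) : set S := [set e | e * e = e].
Arguments idempotents S : clear implicits.

(* Main.v *)
(* For the forward direction, each generator y of the right ideal U `|` US
   satisfies w * y = y for some idempotent w in U; the chosen w form X.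
   For the converse, apply the condition to U = I `&` E(S): if a = a * b * a lies in the
   right ideal I, then the idempotent a * b lies in I and fixes a on the left. *)
Require Import Defs.
From mathcomp Require Import all_boot.
From mathcomp Require Import boolp classical_sets functions cardinality.

Local Open Scope classical_set_scope.
Local Open Scope group_scope.

Lemma right_ideal_generated (S : semigroupType) (U : set S) :
  right_ideal (U `|` set_mul U [set: S]).
Proof.
move=> _ [y Iy] [t _ <-]; right; case: Iy => [Uy|[w Uw [s _ <-]]].
  by exists y => //; exists t.
by exists w => //; exists (s * t) => //; rewrite mulgA.
Qed.

(** An idempotent fixes on the left itself and all its right multiples. *)
Lemma idempotent_left_unit (S : semigroupType) (U : set S) (y : S) :
  U `<=` idempotents S -> (U `|` set_mul U [set: S]) y ->
  exists2 w, U w & w * y = y.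
Proof.
move=> UE [Uy|[w Uw [s _ <-]]]; first by exists y => //; exact: UE.
by exists w => //; rewrite mulgA (UE w Uw).
Qed.

Theorem theorem7p1 (S : semigroupType) (hS : regular_semigroup S) :
  weakly_right_noetherian S <->
  (forall U : set S, U `<=` idempotents S ->
     exists X : set S,
       [/\ finite_set X, X `<=` U &
           forall u : S, U u -> exists x : S, X x /\ u = x * u]).
Proof.
split=> [noeth U UE|cover I rI].
  have [Y [finY YI defI]] := noeth _ (right_ideal_generated _ U).
  have /choice [f fP] : forall y, exists w, Y y -> U w /\ w * y = y.
    (* [choice] needs a value everywhere; outside [Y] the default [y] is arbitrary. *)
    move=> y; have [Yy|nYy] := pselect (Y y); last by exists y.
    by have [w Uw wy] := idempotent_left_unit _ _ _ UE (YI _ Yy); exists w.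
  exists (f @` Y); split; first exact: finite_image.
    by move=> _ [y Yy <-]; case: (fP y Yy).
  move=> u Uu; have : (U `|` set_mul U [set: S]) u by left.
  rewrite defI => -[Yu|[y Yy [s _ <-]]].
    by exists (f u); split; [exists u | case: (fP u Yu)].
  (* A right multiple [y * s] inherits the left unit [f y] of [y]. *)
  by exists (f y); split; [exists y | rewrite mulgA; case: (fP y Yy) => _ ->].
have [X [finX XU XP]] := cover (I `&` idempotents S) (@subIsetr _ _ _).
exists X; split=> //; first by move=> x /XU [].
apply/seteqP; split=> [a Ia|a [/XU []//|[x /XU [Ix _] [s _ <-]]]]; last first.
  by apply: rI; exists x => //; exists s.
have [b [aba _]] := hS a.
have Eab : (a * b) * (a * b) = a * b by rewrite mulgA -aba.
have Iab : I (a * b) by apply: rI; exists a => //; exists b.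
have [x [Xx xab]] := XP _ (conj Iab Eab).
(* In fact [a = x * a]: put [a * b = x * (a * b)] into [a = a * b * a]. *)
right; exists x => //; exists a => //.
by rewrite {1}aba mulgA -xab -aba.
Qed.
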